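(* Let $d \geq 1$ be an integer and let $\mu \in \mathcal{M}^b(\mathbb{R}^d)$ be a bounded measure on $\mathbb{R}^d$ satisfying $\|\mu\| < 1$. Then the series $$\delta_0 + \sum_{k=1}^{\infty} (-1)^k \, \mu^{k\ast}$$ converges in $\mathcal{M}^b(\mathbb{R}^d)$ (with respect to the total variation norm) to a measure $\nu \in \mathcal{M}^b(\mathbb{R}^d)$ which is a convolution inverse of $\delta_0 + \mu$ in the space of bounded measures on $\mathbb{R}^d$, that is, $(\delta_0 + \mu) \ast \nu = \delta_0$.
   Context: $\mathcal{M}^b(\mathbb{R}^d)$ denotes the space of bounded (finite, real-valued signed Borel) measures on $\mathbb{R}^d$, equipped with the total variation norm $\|\mu\| = \mu^+(\mathbb{R}^d) + \mu^-(\mathbb{R}^d)$, where $\mu = \mu^+ - \mu^-$ is the Jordan decomposition. The convolution $\lambda_1 \ast \lambda_2$ of two bounded measures is the bounded measure determined by $\int \varphi \, d(\lambda_1 \ast \lambda_2) = \int \bigl[\int \varphi(x+y)\, d\lambda_1(x)\bigr] d\lambda_2(y)$ for every continuous compactly supported $\varphi : \mathbb{R}^d \to \mathbb{R}$. $\delta_0$ is the unit mass at $0$, the unit element for convolution. For $k \geq 1$, $\mu^{k\ast} = \mu \ast \dots \ast \mu$ ($k$ factors). A convolution inverse of $T$ is a $V$ with $T \ast V = \delta_0$. *)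

(* Defs.v *)
From HB Require Import structures.
From mathcomp Require Import all_boot all_order all_algebra.
From mathcomp Require Import all_classical all_reals all_analysis.

Set Implicit Arguments.
Unset Strict Implicit.
Unset Printing Implicit Defensive.
Import Order.TTheory GRing.Theory Num.Theory.
Import numFieldNormedType.Exports.
Local Open Scope classical_set_scope.
Local Open Scope ring_scope.

Section BoundedMeasures.
Context (R : realType) (d : nat).

Definition Rd := 'rV[R]_d.

(* [Rd] as a measurable type, with the sigma-algebra generated by the open
   sets of the (product) topology of ['rV[R]_d]. *)
Definition borelRd := g_sigma_algebraType (@open Rd).

(* Charges are [fin_num]-valued and sigma-additive on measurable sets. *)
Definition bmeasure := {charge set borelRd -> \bar R}.

(* A charge is a function on all subsets, unconstrained on the non-measurable
   ones, so equality of measures is agreement on Borel sets. *)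
Definition bm_eq (m1 m2 : bmeasure) : Prop :=
  forall A : set borelRd, measurable A -> m1 A = m2 A.

Definition bm_zero : bmeasure := czero.

Definition bm_add (m1 m2 : bmeasure) : bmeasure := cadd m1 m2.

Definition bm_scale (c : R) (m : bmeasure) : bmeasure := cscale c m.

Definition bm_sub (m1 m2 : bmeasure) : bmeasure := bm_add m1 (bm_scale (-1) m2).

Definition bm_delta0 : bmeasure :=
  charge_of_finite_measure (@dirac _ borelRd (0 : Rd) R).

(* The Hahn decomposition is chosen arbitrarily; the Jordan parts [bm_pos] and
   [bm_neg] do not depend on the choice. *)
Definition hahn_pos (m : bmeasure) : set borelRd :=
  projT1 (cid (Hahn_decomposition m)).

Definition hahn_neg (m : bmeasure) : set borelRd :=
  projT1 (cid (projT2 (cid (Hahn_decomposition m)))).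

Definition hahnP (m : bmeasure) :
    hahn_decomposition m (hahn_pos m) (hahn_neg m) :=
  projT2 (cid (projT2 (cid (Hahn_decomposition m)))).

Definition bm_pos (m : bmeasure) : {finite_measure set borelRd -> \bar R} :=
  jordan_pos (hahnP m).

Definition bm_neg (m : bmeasure) : {finite_measure set borelRd -> \bar R} :=
  jordan_neg (hahnP m).

Definition tv_norm (m : bmeasure) : \bar R :=
  (bm_pos m setT + bm_neg m setT)%E.

Definition bm_integral (m : bmeasure) (f : Rd -> R) : R :=
  Rintegral (bm_pos m) setT f - Rintegral (bm_neg m) setT f.

Definition compactly_supported (f : Rd -> R) : Prop :=
  compact (closure [set x : Rd | f x != 0]).

Definition is_convolution (l1 l2 l : bmeasure) : Prop :=
  forall phi : Rd -> R, continuous phi -> compactly_supported phi ->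
    bm_integral l phi =
    bm_integral l2 (fun y => bm_integral l1 (fun x => phi (x + y))).

(* The bounded measure determined by [is_convolution]. Such a measure exists
   for all [l1] and [l2] and is unique up to [bm_eq]; the default value
   [bm_zero] only serves to make the definition total a priori. *)
Definition conv (l1 l2 : bmeasure) : bmeasure :=
  if pselect (exists l, is_convolution l1 l2 l) is left e
  then projT1 (cid e) else bm_zero.

Definition conv_pow (m : bmeasure) (k : nat) : bmeasure :=
  iterop k conv m bm_delta0.

Definition alternating_partial_sum (m : bmeasure) (n : nat) : bmeasure :=
  bm_add bm_delta0
    (\big[bm_add/bm_zero]_(1 <= k < n.+1) bm_scale ((-1) ^+ k) (conv_pow m k)).

Definition tv_cvg (u : nat -> bmeasure) (l : bmeasure) : Prop :=
  (fun n => tv_norm (bm_sub (u n) l)) @ \oo --> 0%E.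

Definition is_conv_inverse (t v : bmeasure) : Prop :=
  bm_eq (conv t v) bm_delta0.

End BoundedMeasures.

(* Main.v *)
Require Import Defs.
From HB Require Import structures.
From mathcomp Require Import all_boot all_order all_algebra.
From mathcomp Require Import all_classical all_reals all_analysis.
From mathcomp Require Import measurable_realfun.
From mathcomp Require Import ring lra.

(** If [m = p - n] with [p], [n] finite positive measures, then integrals
    against [m] are differences of integrals against [p] and [n], and
    [|m| <= p(1) + n(1)]. Hence [l1 * l2], built from push-forwards of products
    of Jordan parts under addition, has norm at most [|l1| |l2|], and the
    Neumann series converges absolutely to some [nu] (sum the positive and the
    negative parts separately). Bounded measures are determined by their
    integrals on [C_c], so to get [(delta_0 + mu) * nu = delta_0] it suffices to
    fix [phi] in [C_c]. With [a_k] the integral of [phi] against [mu^{k*}] and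
    [g(y)] that of [phi(. + y)] against [mu], the function [g] integrates to
    [a_(k+1)] against [mu^{k*}], so [phi + g] integrates against the [n]-th
    partial sum to the telescoping sum [a_0 + (-1)^n a_(n+1)], which tends to
    [a_0 = phi(0)]. No associativity of the convolution is needed. *)

Set Implicit Arguments.
Unset Strict Implicit.
Unset Printing Implicit Defensive.
Import Order.TTheory GRing.Theory Num.Theory.
Import numFieldNormedType.Exports.
Local Open Scope classical_set_scope.
Local Open Scope ring_scope.

(** * Bounded measures as differences of finite measures *)

(** Moving the subtracted terms across turns an identity between signed measures into one between
    positive measures, where the uniqueness results for measures apply. *)
Lemma fin_num_sube_eq (R : realType) (x y z t : \bar R) :
  x \is a fin_num -> y \is a fin_num -> z \is a fin_num -> t \is a fin_num ->
  (x - y = z - t <-> x + t = z + y)%E.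
Proof.
move: x y z t => [x| |] // [y| |] // [z| |] // [t| |] // _ _ _ _.
by rewrite -!EFinB -!EFinD; split => -[] e; congr EFin; lra.
Qed.

(** With the masses of the Jordan parts of [l1] as [x], [y] and of [l2] as [z], [t], this sums the
    masses of the four products in a convolution to the product of the norms. *)
Lemma fin_num_muleDD (R : realType) (x y z t : \bar R) :
  x \is a fin_num -> y \is a fin_num -> z \is a fin_num -> t \is a fin_num ->
  ((x * z + y * t) + (x * t + y * z) = (x + y) * (z + t))%E.
Proof.
move: x y z t => [x| |] // [y| |] // [z| |] // [t| |] // _ _ _ _.
change ((x * z + y * t + (x * t + y * z))%:E = ((x + y) * (z + t))%:E)%R.
by congr EFin; ring.
Qed.

Section FiniteMeasures.
Context dp (T : measurableType dp) (R : realType).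
Implicit Types (p q : {finite_measure set T -> \bar R}) (f g : T -> R).

(** The working class of integrands: it contains $C_c$ and is stable under integrating translates,
    whereas the inner integral of a convolution need not be compactly supported. *)
Definition bounded_measurable f :=
  measurable_fun setT f /\ exists M, forall x, `|f x| <= M.

Lemma bounded_measurable_integrable p f :
  bounded_measurable f -> p.-integrable setT (EFin \o f).
Proof.
move=> [mf [M fM]]; apply: measurable_bounded_integrable => //.
  by rewrite -ge0_fin_numE ?fin_num_measure.
exists M; split; first exact: num_real.
by move=> y My x _; exact: le_trans (fM x) (ltW My).
Qed.

Lemma bounded_measurableD f g : bounded_measurable f -> bounded_measurable g ->
  bounded_measurable (f \+ g).
Proof.
move=> [mf [M fM]] [mg [N gN]]; split; first exact: measurable_funD.
exists (M + N) => x.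
by rewrite (le_trans (ler_normD _ _))// lerD.
Qed.

Lemma Rintegral_le_bound p f M : measurable_fun setT f ->
  (forall x, `|f x| <= M) -> `|Rintegral p setT f| <= M * fine (p setT).
Proof.
move=> mf fM; have bf : bounded_measurable f by split=> //; exists M.
apply: (le_trans (le_normr_Rintegral _ _)) => //.
  exact: bounded_measurable_integrable.
rewrite -Rintegral_cst//; apply: le_Rintegral => //.
- apply: bounded_measurable_integrable; split.
    exact: measurableT_comp.
  by exists M => x; rewrite normr_id.
- apply: bounded_measurable_integrable; split => //.
  by exists `|M|.
Qed.

(** A name of its own for the sum, so that a finiteness instance can be attached to it. *)
Definition finite_measure_add p q : set T -> \bar R := measure_add p q.

Lemma finite_measure_addE p q A : finite_measure_add p q A = (p A + q A)%E.
Proof. exact: measure_addE. Qed.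

HB.instance Definition _ p q := Measure.on (finite_measure_add p q).

Let finite_measure_add_fin p q : fin_num_fun (finite_measure_add p q).
Proof.
by move=> A mA; rewrite finite_measure_addE fin_numD !fin_num_measure.
Qed.

HB.instance Definition _ p q :=
  Measure_isFinite.Build _ _ _ (finite_measure_add p q)
    (@finite_measure_add_fin p q).

Lemma Rintegral_measure_add p q f : bounded_measurable f ->
  Rintegral (finite_measure_add p q) setT f = Rintegral p setT f + Rintegral q setT f.
Proof.
move=> bf; have ip := bounded_measurable_integrable p bf.
have iq := bounded_measurable_integrable q bf.
rewrite /Rintegral [X in fine X](integral_measure_add measurableT ip iq) fineD//;
  exact: integrable_fin_num.
Qed.

(** After the negative terms are moved across, both sides are integrals against sums of measures
    that agree on measurable sets. *)
Lemma eq_Rintegral_diff p q p' q' f : bounded_measurable f ->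
  (forall A, measurable A -> p A + q' A = p' A + q A)%E ->
  Rintegral p setT f - Rintegral q setT f =
  Rintegral p' setT f - Rintegral q' setT f.
Proof.
move=> bf pq; apply/eqP; rewrite subr_eq addrAC eq_sym subr_eq eq_sym; apply/eqP.
rewrite -!Rintegral_measure_add// /Rintegral; congr fine.
by apply: eq_measure_integral => A mA _; rewrite /= !finite_measure_addE pq.
Qed.

End FiniteMeasures.

Section BMeasure.
Context (R : realType) (d : nat).
Implicit Types (m : bmeasure R d) (p n : {finite_measure set (borelRd R d) -> \bar R}).
Implicit Types (f g : borelRd R d -> R).

Lemma bm_decomp m A : measurable A -> m A = (bm_pos m A - bm_neg m A)%E.
Proof.
move=> mA; rewrite (jordan_decomp (hahnP m) mA) /cadd; congr adde.
by rewrite /= /cscale mulN1e.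
Qed.

(** Any decomposition into finite positive measures computes the integral, so the arbitrary Hahn
    decomposition need never be inspected. *)
Lemma bm_integralE m p n f : bounded_measurable f ->
  (forall A, measurable A -> m A = p A - n A)%E ->
  bm_integral m f = Rintegral p setT f - Rintegral n setT f.
Proof.
move=> bf mpn; apply: eq_Rintegral_diff => // A mA.
by apply/fin_num_sube_eq; rewrite ?fin_num_measure// -bm_decomp// mpn.
Qed.

Lemma eq_bm_integral m1 m2 f : bounded_measurable f -> bm_eq m1 m2 ->
  bm_integral m1 f = bm_integral m2 f.
Proof.
by move=> bf m12; apply: bm_integralE => // A mA; rewrite m12// bm_decomp.
Qed.

Lemma tv_norm_fin m : tv_norm m \is a fin_num.
Proof. by rewrite fin_numD !fin_num_measure. Qed.

Lemma tv_norm_ge0 m : (0 <= tv_norm m)%E.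
Proof. by rewrite adde_ge0. Qed.

(** Minimality of the Jordan decomposition: on the positive Hahn set $H$, $m^+(1) = m(H) = p(H) -
    n(H) \le p(H) \le p(1)$, and symmetrically for the negative part. *)
Lemma tv_norm_le m p n :
  (forall A, measurable A -> m A = p A - n A)%E ->
  (tv_norm m <= p setT + n setT)%E.
Proof.
move=> mpn; have [[mP posP] [mN negN] PN PN0] := hahnP m.
apply: leeD.
  rewrite /bm_pos /= jordan_posE cjordan_posE /crestr0 mem_set// /crestr setTI.
  rewrite mpn//; apply: (@le_trans _ _ (p (hahn_pos m))).
    by rewrite leeBlDr ?fin_num_measure// leeDl.
  by apply: le_measure; rewrite ?inE.
rewrite /bm_neg /= jordan_negE cjordan_negE /crestr0 mem_set// /crestr setTI.
rewrite mpn// fin_num_oppeB ?fin_num_measure//.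
apply: (@le_trans _ _ (n (hahn_neg m))).
  by rewrite addeC leeBlDr ?fin_num_measure// leeDl.
by apply: le_measure; rewrite ?inE.
Qed.

Lemma le_tv_norm_eq m1 m2 : bm_eq m1 m2 -> (tv_norm m1 <= tv_norm m2)%E.
Proof. by move=> m12; apply: tv_norm_le => A mA; rewrite m12// bm_decomp. Qed.

Lemma bm_integral_le m f M : measurable_fun setT f ->
  (forall x, `|f x| <= M) -> `|bm_integral m f| <= M * fine (tv_norm m).
Proof.
move=> mf fM; rewrite /bm_integral (le_trans (ler_normB _ _))//.
rewrite fineD ?fin_num_measure// mulrDr.
by apply: lerD; exact: Rintegral_le_bound.
Qed.

Lemma bm_integralD m f g : bounded_measurable f -> bounded_measurable g ->
  bm_integral m (f \+ g) = bm_integral m f + bm_integral m g.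
Proof.
move=> bf bg; rewrite /bm_integral !RintegralD//;
  try exact: bounded_measurable_integrable.
by rewrite opprD addrACA.
Qed.

Lemma bm_integral_add m1 m2 f : bounded_measurable f ->
  bm_integral (bm_add m1 m2) f = bm_integral m1 f + bm_integral m2 f.
Proof.
move=> bf; rewrite (@bm_integralE _ (finite_measure_add (bm_pos m1) (bm_pos m2))
  (finite_measure_add (bm_neg m1) (bm_neg m2)))//; last first.
  move=> A mA; rewrite /= /cadd !finite_measure_addE.
  rewrite (bm_decomp m1 mA) (bm_decomp m2 mA).
  rewrite fin_num_oppeD ?fin_num_measure// addeACA//.
by rewrite !Rintegral_measure_add// opprD addrACA.
Qed.

(** Scaling by -1 exchanges the Jordan parts. Arbitrary powers of -1 reduce to a boolean exponent by
    [signr_odd]. *)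
Lemma bm_integral_sign (b : bool) m f : bounded_measurable f ->
  bm_integral (bm_scale ((-1) ^+ b) m) f = (-1) ^+ b * bm_integral m f.
Proof.
move=> bf; case: b.
  rewrite !expr1 mulN1r /bm_integral opprB; apply: bm_integralE => // A mA.
  rewrite /= /cscale (bm_decomp m mA) mulN1e fin_num_oppeB ?fin_num_measure//.
  by rewrite addeC.
rewrite !expr0 mul1r; apply: eq_bm_integral => // A mA.
by rewrite /= /cscale mul1e.
Qed.

Lemma tv_norm_sign (b : bool) m :
  (tv_norm (bm_scale ((-1) ^+ b) m) <= tv_norm m)%E.
Proof.
case: b; last first.
  by apply: le_tv_norm_eq => A mA; rewrite /= /cscale expr0 mul1e.
rewrite /tv_norm [leRHS]addeC; apply: tv_norm_le => A mA.
rewrite /= /cscale (bm_decomp m mA) expr1 mulN1e fin_num_oppeB ?fin_num_measure//.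
by rewrite addeC.
Qed.

Lemma bm_integral_delta0 f : bounded_measurable f ->
  bm_integral (bm_delta0 R d) f = f 0.
Proof.
move=> bf; rewrite (@bm_integralE _ (@dirac _ (borelRd R d) (0 : Rd R d) R) mzero)//.
  rewrite /Rintegral integral_measure_zero subr0 integral_dirac//; last first.
    by apply/measurable_EFinP; case: bf.
  by rewrite diracE in_setT mul1e.
by move=> A mA; rewrite /mzero sube0.
Qed.

Lemma tv_norm_delta0 : (tv_norm (bm_delta0 R d) <= 1)%E.
Proof.
have := @tv_norm_le (bm_delta0 R d)
  (@dirac _ (borelRd R d) (0 : Rd R d)%R R) mzero.
rewrite /= diracT /mzero adde0; apply => A mA.
by rewrite sube0.
Qed.

End BMeasure.

(** * The Borel sigma-algebra of the row space *)

Section BorelRd.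
Context (R : realType) (d : nat).
Local Notation V := 'rV[R]_d.
Local Notation ratv := (map_mx (@ratr R)).

Lemma ball_mxE (x y : V) (e : R) : ball x e y <-> `|x - y| < e.
Proof. by rewrite -ball_normE. Qed.

Lemma rat_row_dense (x : V) (e : R) : 0 < e ->
  exists q : 'rV[rat]_d, `|x - ratv q| < e.
Proof.
move=> e0.
have /choice[q xq] : forall j, exists q : rat, `|x ord0 j - ratr q| < e.
  move=> j; have [|q] := @rat_in_itvoo R (x ord0 j) (x ord0 j + e).
    by rewrite ltrDl.
  rewrite in_itv/= => /andP[xq qx]; exists q.
  by rewrite ltr_distlC; apply/andP; split; lra.
exists (\row_j q j); apply/ball_mxE; split => // i j.
by rewrite !mxE ord1; exact: xq.
Qed.

(** The factor 4 leaves room for four errors below $1/(k+1)$: for a sum of two vectors, each is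
    compared with another vector through a rational centre. *)
Lemma open_ballP (U : set V) x : open U -> U x ->
  exists k : nat, forall y, `|x - y| < 4 * k.+1%:R^-1 -> U y.
Proof.
move=> oU Ux; have /nbhs_ballP[e /= e0 eU] : nbhs x U by exact: open_nbhs_nbhs.
have [k] : exists k : nat, k.+1%:R^-1 < e / 4.
  have e40 : 0 < e / 4 by rewrite divr_gt0.
  have [k _ kP] := near_infty_natSinv_lt (PosNum e40).
  by exists k; exact: (kP k (leqnn k)).
move=> ke; exists k => y xy; apply: eU; apply/ball_mxE.
by rewrite (lt_trans xy)// -ltr_pdivlMl// mulrC.
Qed.

(** Second countability in explicit form: the balls are indexed by a rational centre and a natural
    number, hence by a countable type. *)
Lemma open_bigcup_rat_ball (U : set V) : open U ->
  U = \bigcup_(q in [set q : 'rV[rat]_d * nat |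
        forall y : V, `|ratv q.1 - y| < q.2.+1%:R^-1 -> U y])
      [set y : V | `|ratv q.1 - y| < q.2.+1%:R^-1].
Proof.
move=> oU; apply/seteqP; split => [x Ux|x [q /= qU /qU]//].
have [k kU] := open_ballP oU Ux.
have k0 : 0 < k.+1%:R^-1 :> R by rewrite invr_gt0.
have [q xq] := rat_row_dense x k0.
exists (q, k) => /=; last by rewrite distrC.
move=> y qy; apply: kU.
rewrite (le_lt_trans (ler_distD (ratv q) x y))// (lt_trans (ltrD xq qy))//.
by move: (_^-1) k0 => r r0; lra.
Qed.

Lemma open_norm_ball (c : V) (r : R) : open [set y : V | `|c - y| < r].
Proof.
have -> : [set y : V | `|c - y| < r] = ball c r.
  by apply/seteqP; split => y /ball_mxE.
exact: ball_open.
Qed.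

Lemma measurable_norm_ball (c : V) (r : R) :
  measurable ([set y : V | `|c - y| < r] : set (borelRd R d)).
Proof. by apply: sub_sigma_algebra; exact: open_norm_ball. Qed.

Lemma countable_bigcup_measurable dp (T : sigmaRingType dp) (I : countType)
    (P : set I) (F : I -> set T) :
  (forall i, measurable (F i)) -> measurable (\bigcup_(i in P) F i).
Proof.
move=> mF; rewrite bigcup_mkcond; apply: countable_bigcupT_measurable.
  exact: countableP.
by move=> i; case: ifPn.
Qed.

(** Continuity of addition is not enough by itself, because the product carries the sigma-algebra
    generated by measurable rectangles. The preimage of an open set is therefore written as a
    countable union of products of rational balls. *)
Lemma measurable_addRd : measurable_fun setT
  ((fun z => (z.1 : V) + (z.2 : V)) : borelRd R d * borelRd R d -> borelRd R d).
Proof.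
set f := (f in measurable_fun _ f).
have := @measurability _ _ _ (borelRd R d) setT f (@open V) erefl.
apply => _ [U oU <-]; rewrite setTI /f.
pose B (q : 'rV[rat]_d) (k : nat) := [set y : V | `|ratv q - y| < k.+1%:R^-1].
have -> : (fun z : V * V => z.1 + z.2) @^-1` U =
  \bigcup_(q in [set q : 'rV[rat]_d * 'rV[rat]_d * nat |
      forall x y, B q.1.1 q.2 x -> B q.1.2 q.2 y -> U (x + y)])
    (B q.1.1 q.2 `*` B q.1.2 q.2).
  apply/seteqP; split => [[x y]/= Uxy|[x y] [q /= qU [/= xq yq]]]; last exact: qU.
  have [k kU] := open_ballP oU Uxy.
  have k0 : 0 < k.+1%:R^-1 :> R by rewrite invr_gt0.
  have [q xq] := rat_row_dense x k0.
  have [q' yq'] := rat_row_dense y k0.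
  exists ((q, q'), k) => /=; last by split => /=; rewrite /B/= distrC.
  move=> x' y' qx' qy'; apply: kU.
  have -> : x + y - (x' + y') = (x - x') + (y - y') by rewrite opprD addrACA.
  rewrite (le_lt_trans (ler_normD _ _))//.
  rewrite (le_lt_trans (lerD (ler_distD (ratv q) x x')
    (ler_distD (ratv q') y y')))//.
  rewrite (lt_le_trans (ltrD (ltrD xq qx') (ltrD yq' qy')))//.
  by move: (_^-1) k0 => r r0; lra.
apply: countable_bigcup_measurable => q.
by apply: measurableX; exact: measurable_norm_ball.
Qed.

Lemma continuous_borel_measurable (f : V -> R) : continuous f ->
  measurable_fun setT (f : borelRd R d -> R).
Proof.
move=> cf.
have := @measurability _ _ (borelRd R d) _ setT f _ (RGenOInfty.measurableE R).
apply => _ [_ [x ->] <-]; rewrite setTI; apply: sub_sigma_algebra.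
by apply: open_comp => // y _; exact: cf.
Qed.

Lemma compactly_supported_sub (f g : V -> R) :
  (forall x, g x != 0 -> f x != 0) -> compactly_supported f ->
  compactly_supported g.
Proof.
move=> fg cf; apply: subclosed_compact cf _; first exact: closed_closure.
exact: closureS.
Qed.

Lemma compactly_supported_bounded (f : V -> R) : continuous f ->
  compactly_supported f -> exists M, forall x, `|f x| <= M.
Proof.
move=> cf sf.
have : compact (f @` closure [set x | f x != 0]).
  by apply: continuous_compact => //; exact: continuous_subspaceT.
move=> /compact_bounded[M [_ /(_ (`|M| + 1))]].
have M1 : M < `|M| + 1 by rewrite (le_lt_trans (ler_norm _))// ltrDl.
move=> /(_ M1) fM; exists (`|M| + 1) => x.
have [->|fx0] := eqVneq (f x) 0; first by rewrite normr0 addr_ge0.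
by apply: fM; exists x => //; exact: subset_closure.
Qed.

Lemma continuous_compact_bounded_measurable (f : V -> R) : continuous f ->
  compactly_supported f -> @bounded_measurable _ (borelRd R d) R f.
Proof.
move=> cf sf; split; first exact: continuous_borel_measurable.
exact: compactly_supported_bounded.
Qed.

(** Serves to exhibit every open ball as the positivity set of a function in $C_c$. *)
Definition tent (c : V) (r : R) (x : V) : R := Num.max 0 (r - `|c - x|).

Lemma tent_gt0 c r x : (0 < tent c r x) = (`|c - x| < r).
Proof. by rewrite /tent lt_max ltxx/= subr_gt0. Qed.

Lemma continuous_tent c r : continuous (tent c r).
Proof.
move=> x; apply: (@continuous_max R V (cst 0) (fun x => r - `|c - x|)).
  exact: cst_continuous.
apply: (@continuousB _ R^o) => //; first exact: cst_continuous.
apply: continuous_comp; last exact: norm_continuous.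
apply: continuousB => //; exact: cst_continuous.
Qed.

Lemma compactly_supported_tent c r : compactly_supported (tent c r).
Proof.
apply: bounded_closed_compact; last exact: closed_closure.
have : closure [set x | tent c r x != 0] `<=` [set x | `|c - x| <= r].
  rewrite [X in _ `<=` X](_ : _ = closure [set x | `|c - x| <= r]).
    apply: closureS => x /=; apply: contraNT; rewrite -ltNge => rx.
    by rewrite /tent max_l// subr_le0 ltW.
  apply/closure_id; rewrite (_ : mkset _ = (fun x => `|c - x|) @^-1` [set y | y <= r])//.
  apply: preimage_closed; last exact: closed_le.
  move=> x _; apply: continuous_comp; last exact: norm_continuous.
  apply: continuousB => //; exact: cst_continuous.
move=> sub; exists (`|c| + r); split; first exact: num_real.
move=> M cM x /sub/= cx; rewrite (le_trans _ (ltW cM))//.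
(* The triangle inequality through [c] bounds the support by $|c| + r$. *)
have := ler_distD c 0 x; rewrite !sub0r !normrN => ?; lra.
Qed.

End BorelRd.

(** * Integrals of compactly supported functions determine a bounded measure *)

Section Uniqueness.
Context (R : realType) (d : nat).
Local Notation V := 'rV[R]_d.
Implicit Types (p q : {finite_measure set (borelRd R d) -> \bar R}).

Definition Cc_nneg (f : V -> R) :=
  [/\ continuous f, compactly_supported f & forall x, 0 <= f x].

(** A pi-system generating the Borel sets, whose members have measures that are limits of integrals
    of functions in $C_c$. *)
Definition Cc_positivity_sets : set (set (borelRd R d)) :=
  [set A | exists2 f : V -> R, Cc_nneg f & A = [set x | 0 < f x]].

Lemma Cc_positivity_sets_setI : setI_closed Cc_positivity_sets.
Proof.
move=> _ _ [f [cf sf f0] ->] [g [cg sg g0] ->].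
exists (fun x => f x * g x).
  split; last by move=> x; rewrite mulr_ge0.
  - by move=> x; exact: continuousM (cf x) (cg x).
  - apply: compactly_supported_sub sf => x.
    by apply: contra_neq => ->; rewrite mul0r.
apply/seteqP; split => [x [/= fx gx]|x /=]; first by rewrite mulr_gt0.
have := f0 x; have := g0 x; rewrite !le_eqVlt.
move=> /predU1P[<-|gx]; first by rewrite mulr0 ltxx.
by move=> /predU1P[<-|fx]; first by rewrite mul0r ltxx.
Qed.

Lemma Cc_nneg_tent (c : V) r : Cc_nneg (tent c r).
Proof.
split; [exact: continuous_tent|exact: compactly_supported_tent|].
by move=> x; rewrite /tent le_max lexx.
Qed.

Lemma Cc_positivity_sets_ball (c : V) (r : R) :
  Cc_positivity_sets [set y : V | `|c - y| < r].
Proof.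
exists (tent c r); first exact: Cc_nneg_tent.
by apply/seteqP; split => x /=; rewrite tent_gt0.
Qed.

(** Open sets are countable unions of rational balls, which are positivity sets; conversely
    positivity sets are open. *)
Lemma measurable_Cc_positivity_sets :
  (measurable : set (set (borelRd R d))) = <<s Cc_positivity_sets >>.
Proof.
apply/seteqP; split; apply: smallest_sub; try exact: smallest_sigma_algebra.
- move=> U oU; rewrite (open_bigcup_rat_ball oU).
  apply: (@countable_bigcup_measurable _
    (g_sigma_algebraType Cc_positivity_sets)) => i.
  by apply: sub_sigma_algebra; exact: Cc_positivity_sets_ball.
- move=> _ [f [cf _ _] ->]; apply: sub_sigma_algebra.
  have -> : [set x : V | 0 < f x] = f @^-1` [set y | 0 < y] by [].
  by apply: open_comp; [move=> x _; exact: cf|exact: open_gt].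
Qed.

(* The functions [min 1 (n f)] are in [C_c] and converge to the indicator
   function of [f > 0]. *)
Lemma measure_Cc_positivity_set_unique p q :
  (forall phi : V -> R, continuous phi -> compactly_supported phi ->
    Rintegral p setT phi = Rintegral q setT phi) ->
  forall A, Cc_positivity_sets A -> p A = q A.
Proof.
move=> pq A [f [cf sf f0] AE].
pose phi (n : nat) (x : V) := Num.min 1 (n%:R * f x).
have cphi n : continuous (phi n).
  move=> x; apply: (@continuous_min R V (cst 1) (fun x => n%:R * f x)).
    exact: cst_continuous.
  by apply: continuousM; [exact: cst_continuous|exact: cf].
have sphi n : compactly_supported (phi n).
  apply: compactly_supported_sub sf => x.
  by apply: contra_neq => fx0; rewrite /phi fx0 mulr0 min_r.
have phi0 n x : 0 <= phi n x by rewrite /phi le_min ler01 mulr_ge0.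
have phi1 n x : phi n x <= 1 by rewrite /phi ge_min lexx.
have mA : measurable A.
  by rewrite measurable_Cc_positivity_sets; apply: sub_sigma_algebra; exists f.
have cvgA (m : {finite_measure set (borelRd R d) -> \bar R}) :
    (\int[m]_x (phi n x)%:E)%E @[n --> \oo] --> m A.
  have -> : m A = (\int[m]_x (\1_A x)%:E)%E by rewrite integral_indic// setIT.
  apply: (@dominated_cvg _ _ _ m setT measurableT (fun n x => (phi n x)%:E) _
    (cst 1%E)).
  - move=> n; apply/measurable_EFinP.
    exact: continuous_borel_measurable.
  - move=> x _; rewrite indicE; apply: cvg_near_cst.
    have := f0 x; rewrite le_eqVlt => /predU1P[fx0|fx0].
      near=> n; rewrite /phi -fx0 mulr0 min_r//.
      by rewrite memNset// AE/= -fx0 ltxx.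
    near=> n; rewrite mem_set ?AE//; congr EFin; rewrite /phi min_l//.
    rewrite -ler_pdivrMr// mul1r ltW//.
    by near: n; exact: nbhs_infty_gtr.
  - by [].
  - apply/integrableP; split => //.
    under eq_integral do rewrite /= normr1.
    by rewrite integral_cst// mul1e -ge0_fin_numE ?fin_num_measure.
  - by move=> n x _; rewrite /= lee_fin ger0_norm.
apply: (cvg_unique _ (cvgA p)); first exact: ereal_hausdorff.
suff -> : (fun n => \int[p]_x (phi n x)%:E)%E = (fun n => \int[q]_x (phi n x)%:E)%E.
  exact: cvgA.
apply/funext => n.
have bphi : @bounded_measurable _ (borelRd R d) R (phi n).
  exact: continuous_compact_bounded_measurable.
have := pq (phi n) (cphi n) (sphi n).
move=> e; have := congr1 EFin e; rewrite /Rintegral !fineK//;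
  by apply: integrable_fin_num => //; exact: bounded_measurable_integrable.
Unshelve. all: by end_near. Qed.

(** Agreement on a generating pi-system extends to all Borel sets; the balls of radius [k] about 0
    belong to it and exhaust the space. *)
Lemma finite_measure_Cc_unique p q :
  (forall phi : V -> R, continuous phi -> compactly_supported phi ->
    Rintegral p setT phi = Rintegral q setT phi) ->
  forall A, measurable A -> p A = q A.
Proof.
move=> pq; apply: (@measure_unique _ _ _ Cc_positivity_sets
    (fun k => [set y : V | `|0 - y| < k%:R])).
- exact: measurable_Cc_positivity_sets.
- exact: Cc_positivity_sets_setI.
- by move=> k; exact: Cc_positivity_sets_ball.
- apply/seteqP; split => // y _; near \oo => k; exists k => //=.
  by near: k; exact: nbhs_infty_gtr.
- exact: measure_Cc_positivity_set_unique.
- move=> k; rewrite -ge0_fin_numE// fin_num_measure//.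
  exact: measurable_norm_ball.
Unshelve. all: by end_near. Qed.

Lemma bmeasure_Cc_unique (m1 m2 : bmeasure R d) :
  (forall phi : V -> R, continuous phi -> compactly_supported phi ->
    bm_integral m1 phi = bm_integral m2 phi) -> bm_eq m1 m2.
Proof.
move=> m12 A mA; rewrite (bm_decomp m1 mA) (bm_decomp m2 mA).
apply/fin_num_sube_eq; rewrite ?fin_num_measure//.
(* What remains compares two positive measures: each positive part plus the negative part of the
   other measure. *)
rewrite -2!finite_measure_addE; apply: finite_measure_Cc_unique => // phi cphi sphi.
have bphi := continuous_compact_bounded_measurable cphi sphi.
rewrite !Rintegral_measure_add//.
by apply/eqP; rewrite -subr_eq addrAC -[_ - _ + _]/(bm_integral m1 phi + _) m12 // subrK.
Qed.

End Uniqueness.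

(** * Convolution *)

Section Convolution.
Context (R : realType) (d : nat).
Local Notation V := 'rV[R]_d.
Local Notation bV := (borelRd R d).
Local Notation addV := ((fun z => (z.1 : V) + (z.2 : V)) : bV * bV -> bV).
Implicit Types (p q : {finite_measure set bV -> \bar R}) (f : bV -> R).

Definition mconv p q : set bV -> \bar R := pushforward (p \x q)%E addV.

Let mconv0 p q : mconv p q set0 = 0%E.
Proof. by rewrite /mconv /pushforward preimage_set0 measure0. Qed.

Let mconv_ge0 p q A : (0 <= mconv p q A)%E.
Proof. by rewrite /mconv /pushforward; exact: (measure_ge0 (p \x q)%E). Qed.

(* [pushforward] is a measure only given a proof of measurability, which
   instance inference cannot supply, hence the explicit instance. *)
Let mconv_sigma_additive p q : semi_sigma_additive (mconv p q).
Proof.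
exact: (@measure_semi_sigma_additive _ _ _
  (measure_function_pushforward__canonical__measure_function_Measure (p \x q)%E
     (@measurable_addRd R d))).
Qed.

HB.instance Definition _ p q := isMeasure.Build _ _ _ (mconv p q)
  (mconv0 p q) (mconv_ge0 p q) (@mconv_sigma_additive p q).

Lemma mconvT p q : mconv p q setT = (p setT * q setT)%E.
Proof.
by rewrite /mconv /pushforward preimage_setT -setXTT product_measure1E.
Qed.

Let mconv_fin p q : fin_num_fun (mconv p q).
Proof.
move=> A mA; rewrite ge0_fin_numE//.
apply: (@le_lt_trans _ _ (mconv p q setT)).
  by apply: le_measure; rewrite ?inE.
by rewrite mconvT -ge0_fin_numE ?mule_ge0// fin_numM// fin_num_measure.
Qed.

HB.instance Definition _ p q :=
  Measure_isFinite.Build _ _ _ (mconv p q) (@mconv_fin p q).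

Lemma prod_integrable_add p q f : bounded_measurable f ->
  (p \x q)%E.-integrable setT (EFin \o (f \o addV)).
Proof.
move=> [mf [M fM]]; apply: measurable_bounded_integrable => //.
(* By unfolding, the mass of [mconv p q] is the mass of the product measure, since the preimage of
   the whole space is the whole space. *)
- have : mconv p q setT \is a fin_num by rewrite fin_num_measure.
  by rewrite ge0_fin_numE.
- exact: (measurableT_comp mf (@measurable_addRd R d)).
- exists M; split; first exact: num_real.
  by move=> y My x _; exact: le_trans (fM _) (ltW My).
Qed.

Lemma bounded_measurable_translate f (y : V) : bounded_measurable f ->
  bounded_measurable (fun x : bV => f ((x : V) + y)).
Proof.
move=> [mf [M fM]]; split; last by exists M.
have mp : measurable_fun setT (fun x : bV => (x, y : bV)).
  exact: measurable_pair2.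
exact: (measurableT_comp mf (measurableT_comp (@measurable_addRd R d) mp)).
Qed.

Lemma bounded_measurable_Rintegral_translate p f : bounded_measurable f ->
  bounded_measurable (fun y : bV =>
    Rintegral p setT (fun x : bV => f ((x : V) + (y : V)))).
Proof.
move=> bf; split.
  apply/measurable_EFinP.
  (* The inner integral involves the first measure alone, so any finite measure can stand as second
     factor; [p] itself is taken. *)
  have := measurable_fubini_G (prod_integrable_add p p bf).
  apply: eq_measurable_fun => y _.
  rewrite /fubini_G /Rintegral/= fineK//.
  by apply: integrable_fin_num => //;
     exact: bounded_measurable_integrable (bounded_measurable_translate _ bf).
have [mf [M fM]] := bf.
exists (M * fine (p setT)) => y.
by apply: Rintegral_le_bound; first by have [] := bounded_measurable_translate y bf.
Qed.

(** Change of variables for the push-forward, then Fubini with [x] as the inner variable, as in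
    [is_convolution]. *)
Lemma Rintegral_mconv p q f : bounded_measurable f ->
  Rintegral (mconv p q) setT f =
  Rintegral q setT
    (fun y : bV => Rintegral p setT (fun x : bV => f ((x : V) + (y : V)))).
Proof.
move=> bf; rewrite /Rintegral; congr fine.
have ipf := prod_integrable_add p q bf.
transitivity (\int[(p \x q)%E]_z ((EFin \o (f \o addV)) z))%E.
  have := @integral_pushforward _ _ _ _ _ _ (@measurable_addRd R d)
    (p \x q)%E setT (EFin \o f) _ ipf measurableT.
  rewrite preimage_setT; apply.
  by apply/measurable_EFinP; case: bf.
rewrite -integral21_prod_meas1//; apply: eq_integral => y _.
rewrite /fubini_G /= fineK//.
by apply: integrable_fin_num => //;
   exact: bounded_measurable_integrable (bounded_measurable_translate _ bf).
Qed.

End Convolution.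

Section BConvolution.
Context (R : realType) (d : nat).
Local Notation V := 'rV[R]_d.
Local Notation bV := (borelRd R d).
Implicit Types (p q : {finite_measure set bV -> \bar R}) (f : bV -> R).
Implicit Types (m l : bmeasure R d).

Definition bm_of_diff p q : bmeasure R d :=
  bm_sub (charge_of_finite_measure p) (charge_of_finite_measure q).

Lemma bm_subE m l A : bm_sub m l A = (m A - l A)%E.
Proof. by rewrite /= /cadd /= /cscale mulN1e. Qed.

Lemma bm_of_diffE p q A : bm_of_diff p q A = (p A - q A)%E.
Proof. exact: bm_subE. Qed.

Lemma bounded_measurable_bm_integral_translate m f : bounded_measurable f ->
  bounded_measurable (fun y : bV => bm_integral m (fun x : bV => f ((x : V) + (y : V)))).
Proof.
move=> bf.
have [mp [M pM]] := bounded_measurable_Rintegral_translate (bm_pos m) bf.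
have [mn [N nN]] := bounded_measurable_Rintegral_translate (bm_neg m) bf.
split; first exact: measurable_funB.
by exists (M + N) => y; rewrite (le_trans (ler_normB _ _))// lerD.
Qed.

(** Expanding the product of two differences of Jordan parts gives four convolutions of positive
    measures; [P] collects those with sign + and [N] those with sign -. *)
Lemma convolution_exists l1 l2 : exists2 l,
  forall f, bounded_measurable f -> bm_integral l f =
    bm_integral l2 (fun y : bV => bm_integral l1 (fun x : bV => f ((x : V) + (y : V)))) &
  (tv_norm l <= tv_norm l1 * tv_norm l2)%E.
Proof.
pose P := finite_measure_add (mconv (bm_pos l1) (bm_pos l2))
                             (mconv (bm_neg l1) (bm_neg l2)).
pose N := finite_measure_add (mconv (bm_pos l1) (bm_neg l2))
                             (mconv (bm_neg l1) (bm_pos l2)).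
exists (bm_of_diff P N).
  move=> f bf; rewrite (@bm_integralE _ _ _ P N)//; last first.
    by move=> A _; exact: bm_of_diffE.
  have bp := bounded_measurable_Rintegral_translate (bm_pos l1) bf.
  have bn := bounded_measurable_Rintegral_translate (bm_neg l1) bf.
  rewrite !Rintegral_measure_add// !Rintegral_mconv//.
  rewrite [in RHS]/bm_integral /= !RintegralB//;
    try exact: bounded_measurable_integrable.
  by rewrite opprB !opprD !addrA; ring.
apply: (le_trans (@tv_norm_le _ _ _ P N _)).
  by move=> A _; exact: bm_of_diffE.
(* The masses of [P] and [N] sum exactly to the product of the norms. *)
rewrite le_eqVlt; apply/orP; left; apply/eqP.
transitivity ((bm_pos l1 setT * bm_pos l2 setT + bm_neg l1 setT * bm_neg l2 setT) +
              (bm_pos l1 setT * bm_neg l2 setT + bm_neg l1 setT * bm_pos l2 setT))%E.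
  by rewrite /= !finite_measure_addE /= !mconvT.
rewrite /tv_norm.
by apply: fin_num_muleDD; exact: fin_num_measure.
Qed.

(* Qualified because [all_analysis] also exports a [conv]. *)
Lemma conv_is_convolution l1 l2 : is_convolution l1 l2 (Defs.conv l1 l2).
Proof.
rewrite /Defs.conv; case: pselect => [e|]; first exact: projT2 (cid e).
move=> []; have [l lP _] := convolution_exists l1 l2; exists l => phi cphi sphi.
exact: (lP _ (continuous_compact_bounded_measurable cphi sphi)).
Qed.

Lemma tv_norm_conv l1 l2 : (tv_norm (Defs.conv l1 l2) <= tv_norm l1 * tv_norm l2)%E.
Proof.
have [l lP] := convolution_exists l1 l2; apply: le_trans.
apply: le_tv_norm_eq; apply: bmeasure_Cc_unique => phi cphi sphi.
rewrite (conv_is_convolution l1 l2)// lP//.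
exact: continuous_compact_bounded_measurable.
Qed.

End BConvolution.

(** * Absolutely convergent series of bounded measures *)

Section FiniteMeasureSeries.
Context dp (T : measurableType dp) (R : realType).
Variables (u : nat -> {finite_measure set T -> \bar R}) (n : nat).
Hypothesis summable_u : (\sum_(n <= k <oo) u k setT < +oo)%E.

(* The unused argument lets instance inference find the proof of finiteness. *)
Definition finite_mseries & (\sum_(n <= k <oo) u k setT < +oo)%E :
  set T -> \bar R := mseries u n.

HB.instance Definition _ := Measure.on (finite_mseries summable_u).

Let finite_mseries_fin : fin_num_fun (finite_mseries summable_u).
Proof.
move=> A mA; rewrite ge0_fin_numE//; apply: le_lt_trans summable_u.
by apply: lee_nneseries => // k _; apply: le_measure; rewrite ?inE.
Qed.

HB.instance Definition _ :=
  Measure_isFinite.Build _ _ _ (finite_mseries summable_u) finite_mseries_fin.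

End FiniteMeasureSeries.

Section Completeness.
Context (R : realType) (d : nat).
Local Notation bV := (borelRd R d).

(** The Jordan parts of the terms are dominated by the norms, so their sums [P 0] and [N 0] are
    finite measures. The distance from [u n] to the limit is at most the tail of the series of
    norms. *)
Lemma tv_summable_cvg (s u : nat -> bmeasure R d) :
  (\sum_(0 <= k <oo) tv_norm (s k) < +oo)%E ->
  (forall n A, measurable A -> u n A = (\sum_(0 <= k < n.+1) s k A)%E) ->
  exists nu, tv_cvg u nu.
Proof.
move=> sfin uE.
have tail_fin n : (\sum_(n <= k <oo) tv_norm (s k) < +oo)%E.
  apply: le_lt_trans sfin.
  rewrite (@nneseries_split _ _ 0 n) ?add0n//; last by move=> *; exact: tv_norm_ge0.
  by rewrite leeDr// sume_ge0// => *; exact: tv_norm_ge0.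
have Pfin n : (\sum_(n <= k <oo) bm_pos (s k) setT < +oo)%E.
  apply: le_lt_trans (tail_fin n); apply: lee_nneseries => // k _.
  by rewrite /tv_norm leeDl.
have Nfin n : (\sum_(n <= k <oo) bm_neg (s k) setT < +oo)%E.
  apply: le_lt_trans (tail_fin n); apply: lee_nneseries => // k _.
  by rewrite /tv_norm leeDr.
pose P n := finite_mseries (Pfin n); pose N n := finite_mseries (Nfin n).
exists (bm_of_diff (P 0) (N 0)).
apply: (@squeeze_cvge _ _ _ _ (cst 0%E) _
    (fun n => \sum_(n.+1 <= k <oo) tv_norm (s k))%E).
- apply: nearW => n; rewrite tv_norm_ge0/=.
  (* The tail [N] comes first because [u n] minus the limit is the negative of the tail of [s], that
     is, [N n.+1] minus [P n.+1]. *)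
  have -> : (\sum_(n.+1 <= k <oo) tv_norm (s k) = N n.+1 setT + P n.+1 setT)%E.
    rewrite addeC /P /N /finite_mseries /mseries/= -nneseriesD//.
  apply: tv_norm_le => A mA.
  rewrite bm_subE bm_of_diffE uE//.
  have PE : (P 0%N A = \sum_(0 <= k < n.+1) bm_pos (s k) A + P n.+1 A)%E.
    by rewrite /P /finite_mseries /mseries/= (@nneseries_split _ _ 0 n.+1).
  have NE : (N 0%N A = \sum_(0 <= k < n.+1) bm_neg (s k) A + N n.+1 A)%E.
    by rewrite /N /finite_mseries /mseries/= (@nneseries_split _ _ 0 n.+1).
  suff: (\sum_(0 <= k < n.+1) s k A - (P 0%N A - N 0%N A) = N n.+1 A - P n.+1 A)%E by [].
  rewrite PE NE.
  have -> : (\sum_(0 <= k < n.+1) s k A = \sum_(0 <= k < n.+1) bm_pos (s k) A -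
     \sum_(0 <= k < n.+1) bm_neg (s k) A)%E.
    rewrite -fin_num_sumeN; last by move=> *; rewrite fin_num_measure.
    by rewrite -big_split/=; apply: eq_bigr => k _; rewrite bm_decomp.
  have : (\sum_(0 <= k < n.+1) bm_pos (s k) A)%E \is a fin_num.
    by apply/sum_fin_numP => *; rewrite fin_num_measure.
  have : (\sum_(0 <= k < n.+1) bm_neg (s k) A)%E \is a fin_num.
    by apply/sum_fin_numP => *; rewrite fin_num_measure.
  have : P n.+1 A \is a fin_num by rewrite fin_num_measure.
  have : N n.+1 A \is a fin_num by rewrite fin_num_measure.
  move: (P n.+1 A) (N n.+1 A) (\sum_(0 <= k < n.+1) bm_pos (s k) A)%E
    (\sum_(0 <= k < n.+1) bm_neg (s k) A)%E.
  move=> [x| |] // [y| |] // [z| |] // [t| |] // _ _ _ _.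
  change ((z - t - (z + x - (t + y)))%:E = (y - x)%:E); congr EFin; ring.
- exact: cvg_cst.
- have tail0 : (\sum_(n <= k <oo) tv_norm (s k))%E @[n --> \oo] --> 0%E.
    by apply: nneseries_tail_cvg => // k _; exact: tv_norm_ge0.
  by move: tail0; rewrite -cvg_shiftS.
Qed.

End Completeness.

(** * The Neumann series *)

Section Neumann.
Context (R : realType) (d : nat).
Local Notation V := 'rV[R]_d.
Local Notation bV := (borelRd R d).
Implicit Types (m l mu : bmeasure R d) (f : bV -> R).

Lemma bm_sumE (I : Type) (r : seq I) (F : I -> bmeasure R d) A :
  (\big[@bm_add R d/@bm_zero R d]_(i <- r) F i) A = (\sum_(i <- r) F i A)%E.
Proof. exact: (big_morph (fun m : bmeasure R d => m A)). Qed.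

Lemma bm_integral_zero f : bounded_measurable f -> bm_integral (bm_zero R d) f = 0.
Proof.
move=> bf; rewrite (@bm_integralE _ _ _ mzero mzero)//; first by rewrite subrr.
by move=> A _; rewrite /= sube0.
Qed.

Lemma bm_integral_sum (I : Type) (r : seq I) (F : I -> bmeasure R d) f :
  bounded_measurable f ->
  bm_integral (\big[@bm_add R d/@bm_zero R d]_(i <- r) F i) f =
  \sum_(i <- r) bm_integral (F i) f.
Proof.
move=> bf; apply: (big_morph (fun m => bm_integral m f)).
  by move=> m l; exact: bm_integral_add.
exact: bm_integral_zero.
Qed.

Lemma bm_integral_sub m l f : bounded_measurable f ->
  bm_integral (bm_sub m l) f = bm_integral m f - bm_integral l f.
Proof.
move=> bf; rewrite bm_integral_add//; congr (_ + _).
by have := bm_integral_sign true l bf; rewrite expr1 mulN1r.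
Qed.

(** If $|f| \le M$, the integrals of $f$ differ by at most $M$ times the norm of
    [bm_sub (u n) m]. *)
Lemma tv_cvg_bm_integral (u : nat -> bmeasure R d) m f :
  bounded_measurable f -> tv_cvg u m ->
  bm_integral (u n) f @[n --> \oo] --> bm_integral m f.
Proof.
move=> bf um; have [mf [M fM]] := bf.
have /fine_cvgP[_ um0] := um.
apply/subr_cvg0; apply/norm_cvg0P.
apply: (@squeeze_cvgr _ _ _ _ (cst 0) (fun n => M * fine (tv_norm (bm_sub (u n) m)))).
- by apply: nearW => n; rewrite normr_ge0/= -bm_integral_sub//; exact: bm_integral_le.
- exact: cvg_cst.
- by rewrite -(mulr0 M); apply: cvgM um0; exact: cvg_cst.
Qed.

(** [iterop] makes the first power [mu] itself, with no factor [bm_delta0]. The recursion thus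
    starts at exponent 2, and the exponents 0 and 1 are treated apart. *)
Lemma conv_pow_recl mu k : conv_pow mu k.+2 = Defs.conv mu (conv_pow mu k.+1).
Proof. by []. Qed.

Lemma tv_norm_conv_pow mu k :
  (tv_norm (conv_pow mu k) <= (fine (tv_norm mu) ^+ k)%:E)%E.
Proof.
have muE : tv_norm mu = (fine (tv_norm mu))%:E by rewrite fineK// tv_norm_fin.
case: k => [|k]; first exact: tv_norm_delta0.
elim: k => [|k IHk]; first by rewrite expr1 -muE.
rewrite conv_pow_recl (le_trans (tv_norm_conv _ _))// exprS EFinM -muE.
by rewrite lee_pmul// tv_norm_ge0.
Qed.

(** For positive [k] this is the defining identity of the convolution; for [k] zero, integrating
    against [bm_delta0] evaluates the inner integral at 0. *)
Lemma bm_integral_conv_powS mu k (phi : V -> R) :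
  continuous phi -> compactly_supported phi ->
  bm_integral (conv_pow mu k)
    (fun y : bV => bm_integral mu (fun x : bV => phi ((x : V) + (y : V)))) =
  bm_integral (conv_pow mu k.+1) phi.
Proof.
move=> cphi sphi.
have bphi := continuous_compact_bounded_measurable cphi sphi.
case: k => [|k]; last first.
  by rewrite conv_pow_recl; symmetry; exact: (conv_is_convolution mu _).
rewrite bm_integral_delta0; last exact: bounded_measurable_bm_integral_translate.
by congr bm_integral; apply/funext => x; rewrite addr0.
Qed.

(** The separate unit is the zeroth power and becomes the term of index 0. *)
Lemma alternating_partial_sumE mu n A :
  alternating_partial_sum mu n A =
  (\sum_(0 <= k < n.+1) bm_scale ((-1) ^+ k) (conv_pow mu k) A)%E.
Proof.
transitivity (bm_delta0 R d A + (\big[@bm_add R d/@bm_zero R d]_(1 <= k < n.+1)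
    bm_scale ((-1) ^+ k) (conv_pow mu k)) A)%E; first by [].
rewrite bm_sumE [RHS]big_nat_recl// big_add1; congr (_ + _)%E.
by rewrite /= /cscale expr0 mul1e.
Qed.

Lemma bm_integral_scale_sign k m f : bounded_measurable f ->
  bm_integral (bm_scale ((-1) ^+ k) m) f = (-1) ^+ k * bm_integral m f.
Proof. by move=> bf; rewrite -signr_odd bm_integral_sign. Qed.

Lemma bm_integral_alternating_partial_sum mu n f : bounded_measurable f ->
  bm_integral (alternating_partial_sum mu n) f =
  \sum_(0 <= k < n.+1) (-1) ^+ k * bm_integral (conv_pow mu k) f.
Proof.
move=> bf; rewrite /alternating_partial_sum bm_integral_add// bm_integral_sum//.
rewrite [RHS]big_nat_recl// expr0 mul1r big_add1/=; congr (_ + _).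
by apply: eq_bigr => k _; rewrite bm_integral_scale_sign.
Qed.

Lemma sum_alternating_telescope (a : nat -> R) n :
  \sum_(0 <= k < n.+1) (-1) ^+ k * (a k + a k.+1) = a 0%N + (-1) ^+ n * a n.+1.
Proof.
elim: n => [|n IHn]; first by rewrite big_nat1 expr0 !mul1r.
by rewrite big_nat_recr//= IHn exprS; ring.
Qed.

Section SmallNorm.
Variable mu : bmeasure R d.
Hypothesis mu_lt1 : (tv_norm mu < 1)%E.

Let r := fine (tv_norm mu).

Let r_ge0 : 0 <= r. Proof. by rewrite fine_ge0// tv_norm_ge0. Qed.

Let r_lt1 : r < 1.
Proof. by rewrite -lte_fin fineK// tv_norm_fin. Qed.

Let r_norm : `|r| < 1. Proof. by rewrite ger0_norm. Qed.

(** Comparison with the geometric series of ratio [r]. *)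
Lemma tv_norm_conv_pow_summable :
  (\sum_(0 <= k <oo) tv_norm (bm_scale ((-1) ^+ k) (conv_pow mu k)) < +oo)%E.
Proof.
apply: (@le_lt_trans _ _ (\sum_(0 <= k <oo) (r ^+ k)%:E)%E).
  apply: lee_nneseries => [k _ _|k _]; first exact: tv_norm_ge0.
  rewrite -signr_odd (le_trans (tv_norm_sign _ _))//; exact: tv_norm_conv_pow.
have geo : (\sum_(0 <= k < n) (r ^+ k)%:E)%E @[n --> \oo] --> (1 / (1 - r))%:E.
  under eq_fun do rewrite sumEFin.
  apply: cvg_EFin; first exact: nearW.
  have := @cvg_geometric_series _ 1 _ r_norm.
  by rewrite /series/=; under eq_fun do under eq_bigr do rewrite mul1r.
by rewrite (cvg_lim _ geo)// ltry.
Qed.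

Lemma bm_integral_conv_pow_cvg0 f : bounded_measurable f ->
  bm_integral (conv_pow mu n) f @[n --> \oo] --> 0.
Proof.
move=> [mf [M fM]]; apply/norm_cvg0P.
apply: (@squeeze_cvgr _ _ _ _ (cst 0) (geometric M r)).
- apply: nearW => n; rewrite normr_ge0/=.
  rewrite (le_trans (bm_integral_le _ mf fM))// ler_wpM2l//.
    (* The bound [M] is nonnegative because it dominates a norm. *)
    exact: le_trans (normr_ge0 _) (fM 0).
  by rewrite -lee_fin fineK ?tv_norm_fin// tv_norm_conv_pow.
- exact: cvg_cst.
- exact: cvg_geometric.
Qed.

Lemma conv_inverse_tv_limit nu : tv_cvg (alternating_partial_sum mu) nu ->
  is_conv_inverse (bm_add (bm_delta0 R d) mu) nu.
Proof.
move=> cnu; apply: bmeasure_Cc_unique => phi cphi sphi.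
have bphi := continuous_compact_bounded_measurable cphi sphi.
rewrite (conv_is_convolution _ nu)// bm_integral_delta0//.
pose g (y : bV) := bm_integral mu (fun x : bV => phi ((x : V) + (y : V))).
have bg : bounded_measurable g by exact: bounded_measurable_bm_integral_translate.
(* Integrating the translate of [phi] by [y] against $\delta_0 + \mu$ gives [phi y + g y]. *)
transitivity (bm_integral nu ((phi : bV -> R) \+ g)).
  congr bm_integral; apply/funext => y.
  have bt := bounded_measurable_translate y bphi.
  by rewrite bm_integral_add// bm_integral_delta0//= add0r.
pose a k := bm_integral (conv_pow mu k) phi.
have partial n : bm_integral (alternating_partial_sum mu n) ((phi : bV -> R) \+ g) =
    a 0%N + (-1) ^+ n * a n.+1.
  rewrite bm_integral_alternating_partial_sum; last exact: bounded_measurableD.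
  rewrite -sum_alternating_telescope; apply: eq_bigr => k _.
  by rewrite bm_integralD// bm_integral_conv_powS.
(* The integrals of [phi + g] against the partial sums tend to the one against [nu]; by uniqueness
   of limits, it suffices that they also tend to [phi 0]. *)
have := tv_cvg_bm_integral (bounded_measurableD bphi bg) cnu.
under eq_fun do rewrite partial.
move/(cvg_unique (@Rhausdorff R)); apply.
rewrite /= -[phi 0]addr0; apply: cvgD. 
  by rewrite /a bm_integral_delta0//; exact: cvg_cst.
(* Passing to norms and back removes the alternating sign. *)
apply/norm_cvg0P.
under eq_fun do rewrite normrM normrX normrN1 expr1n mul1r.
apply/norm_cvg0P.
have := bm_integral_conv_pow_cvg0 bphi.
by rewrite -cvg_shiftS.
Qed.

End SmallNorm.

End Neumann.

Theorem theorem1 (R : realType) (d : nat) (hd : (0 < d)%N)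
    (mu : bmeasure R d) (hmu : (tv_norm mu < 1)%E) :
  exists nu : bmeasure R d,
    tv_cvg (alternating_partial_sum mu) nu /\
    is_conv_inverse (bm_add (bm_delta0 R d) mu) nu.
Proof.
have [nu cnu] := tv_summable_cvg (tv_norm_conv_pow_summable hmu)
  (fun n A _ => alternating_partial_sumE mu n A).
by exists nu; split=> //; exact: conv_inverse_tv_limit.
Qed.
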